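(* Let $\sigma : A \to A^+$ be a substitution. Suppose that $\sigma$ is tame and $l$-primitive. Then $(X_{\sigma},T)$ is minimal. Conversely, suppose that $(X_{\sigma},T)$ is minimal and is not a single periodic orbit. Then the substitution $\sigma$ is tame, and there exist a subalphabet $B \subseteq A$ and the restriction $\sigma|_B : B \to B^+$ (that is, $\sigma(B) \subseteq B^+$ and $\sigma|_B$ is a substitution on $B$) such that $\sigma|_B$ is tame and $l$-primitive and $(X_{\sigma},T) = (X_{\sigma|_B},T)$.
   Context: An alphabet $A$ is a finite set with at least two elements (one-letter alphabets are excluded); its elements are letters. $A^+$ is the set of all words over $A$ of positive finite length, $\epsilon$ is the empty word, $A^* = A^+ \cup \{\epsilon\}$, and $|w|$ is the length of $w$. A word $v$ is a subword (factor) of $w$ if $w = u v u'$ for some $u,u' \in A^*$. A map $\sigma : A \to A^+$ extends to $\sigma : A^* \to A^*$ by concatenation and $\sigma(\epsilon)=\epsilon$, so the iterates $\sigma^n$ are defined. Put $A_l := \{a \in A : \lim_{n\to\infty} |\sigma^n(a)| = \infty\}$ and $A_s := A \setminus A_l$. A letter $b \in A$ is isolated if $b \in A_s$ and $b$ does not appear in any $\sigma^n(a)$ with $a \in A_l$, $n \ge 1$; $A_{\mathrm{iso}}$ is the set of isolated letters. $\sigma$ is called a substitution if $A_l \ne \emptyset$ and $A_{\mathrm{iso}} = \emptyset$. The language $\mathcal{L}(\sigma) \subseteq A^*$ is the set of all words that are subwords of $\sigma^n(a)$ for some $a \in A$ and $n \ge 1$. For $x \in A^{\mathbb{Z}}$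 and integers $s \le t$, $x[s,t] := x(s)x(s+1)\cdots x(t)$. Define $X_\sigma := \{x \in A^{\mathbb{Z}} : x[s,t] \in \mathcal{L}(\sigma) \text{ for all integers } s<t\}$. $T : A^{\mathbb{Z}} \to A^{\mathbb{Z}}$ is the left shift; a subshift is a closed set $\Lambda \subseteq A^{\mathbb{Z}}$ (product topology) with $T(\Lambda)=\Lambda$, written $(\Lambda,T)$. A subshift is minimal if it contains no nonempty proper subshift. For $B \subseteq A$, $B^{\mathbb{Z}}$ is regarded as a subset of $A^{\mathbb{Z}}$, and $X_{\sigma|_B}$ is formed from the map $\sigma|_B$ on the alphabet $B$. A substitution $\sigma$ is $l$-primitive if there exists $n \ge 1$ such that for all $a,b \in A_l$, $a$ is a letter in $\sigma^n(b)$. A letter $a \in A_l$ is left-isolated if there is $n \ge 1$ with $\sigma^n(a) = u\,a\,w$ for some $u \in A_s^+$ and $w \in A^*$; it is right-isolated if there is $n \ge 1$ with $\sigma^n(a) = w\,a\,u$ for some $w \in A^*$ and $u \in A_s^+$ (here $A_s^+$ is the set of nonempty words over $A_s$). $\sigma$ is tame if no letter in $A_l$ is left-isolated and no letter in $A_l$ is right-isolated. *)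

(* Defs.v *)
From HB Require Import structures.
From mathcomp Require Import all_boot all_order all_algebra.
From mathcomp Require Import all_classical topology.

Set Implicit Arguments.
Unset Strict Implicit.
Unset Printing Implicit Defensive.

Import Order.TTheory GRing.Theory Num.Theory.

Local Open Scope classical_set_scope.

Definition subst_extend (A : finType) (sigma : A -> seq A) (w : seq A) : seq A :=
  flatten (map sigma w).

Definition subst_iter (A : finType) (sigma : A -> seq A) (n : nat) (a : A) :
    seq A :=
  iter n (subst_extend sigma) [:: a].

Definition long_letters (A : finType) (sigma : A -> seq A) : set A :=
  [set a | (fun n => size (subst_iter sigma n a)) @ \oo --> \oo].

Definition short_letters (A : finType) (sigma : A -> seq A) : set A :=
  ~` long_letters sigma.

Definition short_word (A : finType) (sigma : A -> seq A) (u : seq A) : Prop :=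
  u <> [::] /\ forall c, c \in u -> short_letters sigma c.

Definition isolated_letters (A : finType) (sigma : A -> seq A) : set A :=
  [set b | short_letters sigma b /\
     forall (a : A) (n : nat), long_letters sigma a -> (1 <= n)%N ->
       b \notin subst_iter sigma n a].

(* That an alphabet has at least two letters is required separately, wherever
   an alphabet is introduced. *)
Definition substitution (A : finType) (sigma : A -> seq A) : Prop :=
  [/\ forall a, sigma a <> [::],
      long_letters sigma !=set0 &
      isolated_letters sigma = set0].

Definition l_primitive (A : finType) (sigma : A -> seq A) : Prop :=
  exists2 n, (1 <= n)%N &
    forall a b, long_letters sigma a -> long_letters sigma b ->
      a \in subst_iter sigma n b.

Definition left_isolated (A : finType) (sigma : A -> seq A) (a : A) : Prop :=
  exists (n : nat) (u w : seq A),
    [/\ (1 <= n)%N, short_word sigma u & subst_iter sigma n a = u ++ a :: w].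

Definition right_isolated (A : finType) (sigma : A -> seq A) (a : A) : Prop :=
  exists (n : nat) (w u : seq A),
    [/\ (1 <= n)%N, short_word sigma u & subst_iter sigma n a = w ++ a :: u].

Definition tame (A : finType) (sigma : A -> seq A) : Prop :=
  forall a, long_letters sigma a ->
    ~ left_isolated sigma a /\ ~ right_isolated sigma a.

Definition fullshift (A : finType) : topologicalType :=
  prod_topology (fun _ : int => discrete_topology A).

Definition shift (A : finType) (x : fullshift A) : fullshift A :=
  fun i : int => x (i + 1)%R.

Definition subshift (A : finType) (L : set (fullshift A)) : Prop :=
  closed L /\ shift (A := A) @` L = L.

Definition minimal_subshift (A : finType) (L : set (fullshift A)) : Prop :=
  subshift L /\
  ~ exists L' : set (fullshift A), [/\ subshift L', L' !=set0 & L' `<` L].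

Definition periodic_orbit (A : finType) (L : set (fullshift A)) : Prop :=
  exists (x : fullshift A) (p : nat),
    [/\ (1 <= p)%N, iter p (@shift A) x = x &
        L = range (fun n : nat => iter n (@shift A) x)].

(* The word x(s) x(s+1) ... x(t); meaningful only for s <= t. *)
Definition window (A : finType) (x : fullshift A) (s t : int) : seq A :=
  [seq x (s + i%:Z)%R | i <- iota 0 (absz (t - s)%R).+1].

Definition language (A : finType) (sigma : A -> seq A) : set (seq A) :=
  [set w | exists (a : A) (n : nat),
     (1 <= n)%N /\ infix w (subst_iter sigma n a)].

Definition subst_shift (A : finType) (sigma : A -> seq A) :
    set (fullshift A) :=
  [set x | forall s t : int, (s < t)%R -> language sigma (window x s t)].

Definition stable (A : finType) (sigma : A -> seq A) (B : {set A}) : Prop :=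
  forall b c, b \in B -> c \in sigma b -> c \in B.

(* [pmap insub] retypes each letter in B and drops the others; when [B] is
   stable nothing is dropped. *)
Definition subst_restrict (A : finType) (sigma : A -> seq A) (B : {set A}) :
    {b : A | b \in B} -> seq {b : A | b \in B} :=
  fun b => pmap insub (sigma (val b)).
Arguments subst_restrict {A} sigma B.

Definition include_full (A : finType) (B : {set A})
    (y : fullshift {b : A | b \in B}) : fullshift A :=
  fun i : int => val (y i : {b : A | b \in B}).

(* Main.v *)
(** If sigma is tame, the short factors of the language have bounded length: a
    letter at which first (or last) long letters cycle would otherwise be
    isolated.  Hence every long factor of a point of X contains sigma^m(b) for a
    long letter b, and by l-primitivity any given word of the language, so every
    orbit in X is dense.

    Conversely, an isolated long letter puts all powers of some nonempty word in
    the language, and then minimality makes X the orbit of a periodic point.  So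
    sigma is tame, and every point of X contains a long letter.  Fix N such that
    sigma^(kN)(a) and sigma^N(a) have the same letters for all k >= 1.  For each
    long d, the factors of the words sigma^(kN)(d) generate a nonempty subshift
    of X, which is X; therefore a long letter d0 of a point of X occurs in
    sigma^N(d) for every long d.  The letters reachable from d0 form B. *)
Require Import Defs.
From mathcomp Require Import all_boot all_order all_algebra.
From mathcomp Require Import all_classical topology.
From mathcomp Require Import zify.

Set Implicit Arguments.
Unset Strict Implicit.
Unset Printing Implicit Defensive.

Import GRing.Theory.
Local Open Scope classical_set_scope.

(** * Factors of words and iterates *)

Section Words.
Variable T : eqType.
Implicit Types (u v w s r : seq T) (p : pred T).

Lemma prefix_cat_split u s r : prefix u (s ++ r) ->
  prefix u s \/ exists2 v, u = s ++ v & prefix v r.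
Proof.
case/prefixP => x e.
have [le|lt] := leqP (size u) (size s).
  left; apply/prefixP; exists (drop (size u) s).
  have := congr1 (take (size u)) e.
  by rewrite takel_cat // (take_size_cat x erefl) => {1}<-; rewrite cat_take_drop.
right; exists (drop (size s) u).
  have := congr1 (take (size s)) e.
  by rewrite (take_size_cat r erefl) takel_cat 1?ltnW // => {1}->; rewrite cat_take_drop.
apply/prefixP; exists x; have := congr1 (drop (size s)) e.
by rewrite (drop_size_cat r erefl) drop_cat lt.
Qed.

Lemma infix_cat_split u s r : infix u (s ++ r) ->
  [\/ infix u s, infix u r |
      exists u1 u2, [/\ u = u1 ++ u2, suffix u1 s & prefix u2 r]].
Proof.
case/infixP => x [y e].
have [le|lt] := leqP (size s) (size x).
  apply: Or32; apply/infixP; exists (drop (size s) x), y.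
  have := congr1 (drop (size s)) e; rewrite (drop_size_cat r erefl) drop_cat.
  case: ltnP => // le2 ->; have es : size s = size x by apply/eqP; rewrite eqn_leq le.
  by rewrite es subnn drop0 drop_size.
have es : s = x ++ drop (size x) s.
  have := congr1 (take (size x)) e.
  by rewrite (take_size_cat _ erefl) takel_cat 1?ltnW // => {1}<-; rewrite cat_take_drop.
have e' : drop (size x) s ++ r = u ++ y.
  by have := congr1 (drop (size x)) e; rewrite (drop_size_cat _ erefl) drop_cat lt.
have /prefix_cat_split[pu|[v eu pv]] : prefix u (drop (size x) s ++ r).
- by apply/prefixP; exists y.
- by apply: Or31; rewrite es; apply: infix_catl; apply: prefixW.
- apply: Or33; exists (drop (size x) s), v; split=> //.
  by apply/suffixP; exists x.
Qed.

Lemma all_prefix_flatten p P (ss : seq (seq T)) u :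
  (forall s v, s \in ss -> prefix v s -> all p v -> size v <= P) ->
  prefix u (flatten ss) -> all p u -> size u <= P * size ss.
Proof.
elim: ss u => [|s ss IH] u hP /=; first by case: u.
case/prefix_cat_split => [pu au|[v -> pv]].
  by rewrite mulnS (leq_trans (hP s u _ _ _)) ?mem_head ?leq_addr.
rewrite all_cat size_cat mulnS => /andP[a1 a2].
apply: leq_add; first by apply: (hP s); rewrite ?mem_head ?prefix_refl.
by apply: IH => // s' v' s'ss; apply: hP; rewrite in_cons s'ss orbT.
Qed.

(** Either [u] stays inside one piece, which costs [K], or it crosses a boundary and splits into a
    suffix of one piece and a prefix of the remaining ones, which costs at most [P] per piece. *)
Lemma all_infix_flatten p P K (ss : seq (seq T)) u :
  (forall s v, s \in ss -> prefix v s -> all p v -> size v <= P) ->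
  (forall s v, s \in ss -> suffix v s -> all p v -> size v <= P) ->
  (forall s v, s \in ss -> infix v s -> all p v -> size v <= K) ->
  infix u (flatten ss) -> all p u -> size u <= maxn K (P * size ss).
Proof.
elim: ss u => [|s ss IH] u hP hS hK /=; first by case: u.
have sub (Q : seq T -> seq T -> Prop) :
    (forall s' v, s' \in s :: ss -> Q s' v) -> forall s' v, s' \in ss -> Q s' v.
  by move=> h s' v s'ss; apply: h; rewrite in_cons s'ss orbT.
case/infix_cat_split => [iu au|iu au|[u1 [u2 [-> s1 p2]]]].
- by rewrite leq_max (hK s) ?mem_head.
- have := IH u (sub (fun s v => _) hP) (sub (fun s v => _) hS)
    (sub (fun s v => _) hK) iu au.
  by rewrite !leq_max mulnS => /orP[->//|h]; rewrite (leq_trans h (leq_addl _ _)) orbT.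
- rewrite all_cat size_cat mulnS leq_max => /andP[a1 a2]; apply/orP; right.
  apply: leq_add; first by apply: (hS s); rewrite ?mem_head.
  exact: all_prefix_flatten (sub (fun s v => _) hP) p2 a2.
Qed.

Lemma size_flatten_le m (ss : seq (seq T)) :
  (forall s, s \in ss -> size s <= m) -> size (flatten ss) <= m * size ss.
Proof.
move=> h; apply: (@all_prefix_flatten predT); rewrite ?prefix_refl ?all_predT //.
by move=> s v /h + /size_prefix + _; move=> ? ?; apply: leq_trans; eassumption.
Qed.

(** What [u] has beyond the images of the letters of [v] lies in one further image, hence [.+1]. *)
Lemma prefix_desubst m (g : T -> seq T) w u : (forall c, size (g c) <= m) ->
  prefix u (flatten (map g w)) ->
  exists v, [/\ prefix v w, prefix (flatten (map g v)) u & size u <= m * (size v).+1].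
Proof.
move=> gm; elim: w u => [|c w IH] u /=.
  by case: u => // _; exists [::]; split.
case/prefix_cat_split => [pu|[u' -> pu']].
  exists [::]; split=> //=; first exact: prefix0s.
  by rewrite muln1; apply: leq_trans (size_prefix pu) (gm c).
have [v [pv iv sv]] := IH _ pu'; exists (c :: v); split.
- by rewrite /= eqxx.
- by have /prefixP[x ->] := iv; rewrite /= catA prefix_prefix.
- by rewrite size_cat mulnS; apply: leq_add.
Qed.

(** Here an image may be cut at each end of [u], hence [.+2]. *)
Lemma infix_desubst m (g : T -> seq T) w u : (forall c, size (g c) <= m) ->
  infix u (flatten (map g w)) ->
  exists v, [/\ infix v w, infix (flatten (map g v)) u & size u <= m * (size v).+2].
Proof.
move=> gm; elim: w u => [|c w IH] u /=.
  by case: u => // _; exists [::]; split.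
case/infix_cat_split => [iu|iu|[u1 [u2 [-> s1 p2]]]].
- exists [::]; split; rewrite ?infix0s //=.
  by apply: leq_trans (leq_trans (size_infix iu) (gm c)) _; rewrite muln2 -addnn leq_addr.
- have [v [iv gv sv]] := IH _ iu; exists v; split=> //.
  exact: infix_trans iv (infix_cons _ _).
- have [v [pv gv sv]] := prefix_desubst gm p2; exists v; split.
  + exact: infix_trans (prefixW pv) (infix_cons _ _).
  + by apply: infix_catl; apply: prefixW.
  + rewrite size_cat mulnS leq_add //.
    exact: leq_trans (size_suffix s1) (gm c).
Qed.

End Words.

Lemma finite_uniform_bound (I : finType) (P : I -> nat -> Prop) :
  (forall i m n, m <= n -> P i m -> P i n) -> (forall i, exists m, P i m) ->
  exists m, forall i, P i m.
Proof.
move=> mono /choice[f Pf]; exists (\max_i f i) => i.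
exact: mono (leq_bigmax i) (Pf i).
Qed.

Lemma image_size_bound (I : finType) (T : Type) (g : I -> seq T) :
  exists C, forall i, size (g i) <= C.
Proof. by exists (\max_i size (g i)) => i; apply: (leq_bigmax (F := fun j => size (g j))). Qed.

Lemma finite_pigeonhole (F : finType) (g : nat -> F) :
  exists i j, i < j /\ g i = g j.
Proof.
have /injectivePn[x [y xy e]] : ~~ injectiveb (fun i : 'I_#|F|.+1 => g i).
  by apply/injectiveP => /leq_card; rewrite card_ord ltnn.
have [lt|gt|/val_inj eq] := ltngtP x y.
- by exists x, y.
- by exists y, x.
- by rewrite eq eqxx in xy.
Qed.

(** * Growth of iterates: long and short letters *)

Section Iterates.
Variables (A : finType) (sigma : A -> seq A).
Implicit Types (a b c d : A) (u v w : seq A).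

Local Notation pow n w := (iter n (subst_extend sigma) w).
Local Notation long := (long_letters sigma).
Local Notation short := (short_letters sigma).

Lemma subst_iter_cat n u v : pow n (u ++ v) = pow n u ++ pow n v.
Proof.
by elim: n => //= n ->; rewrite /subst_extend map_cat flatten_cat.
Qed.

Lemma subst_iter_flatten n w : pow n w = flatten (map (subst_iter sigma n) w).
Proof.
elim: w => [|a w IH]; first by elim: n => //= n ->.
by rewrite -cat1s subst_iter_cat IH.
Qed.

Lemma subst_iterD m n a : subst_iter sigma (m + n) a = pow m (subst_iter sigma n a).
Proof. exact: iterD. Qed.

Lemma mem_subst_iter n w c : c \in pow n w -> exists2 b, b \in w & c \in subst_iter sigma n b.
Proof. by rewrite subst_iter_flatten => /flatten_mapP. Qed.

Lemma mem_subst_iterI n w b c : b \in w -> c \in subst_iter sigma n b -> c \in pow n w.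
Proof. by move=> bw cb; rewrite subst_iter_flatten; apply/flatten_mapP; exists b. Qed.

Lemma mem_subst_iterD m n a b c : b \in subst_iter sigma n a ->
  c \in subst_iter sigma m b -> c \in subst_iter sigma (m + n) a.
Proof. by rewrite subst_iterD; apply: mem_subst_iterI. Qed.

Lemma infix_subst_iter n u w : infix u w -> infix (pow n u) (pow n w).
Proof.
by case/infixP => x [y ->]; rewrite !subst_iter_cat; apply: infix_infix.
Qed.

Hypothesis sigma_ne : forall a, sigma a <> [::].

Lemma size_subst_iter n w : size w <= size (pow n w).
Proof.
elim: n => //= n; move/leq_trans; apply; elim: (pow n w) => //= a v IH.
rewrite /subst_extend /= size_cat -add1n leq_add //.
by case: (sigma a) (sigma_ne (a := a)).
Qed.

Lemma size_subst_iter_mono m n a : m <= n ->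
  size (subst_iter sigma m a) <= size (subst_iter sigma n a).
Proof. by move=> /subnK <-; rewrite subst_iterD size_subst_iter. Qed.

Lemma subst_iter_eq0 n w : pow n w = [::] -> w = [::].
Proof.
by move=> e; apply/eqP; rewrite -size_eq0 -leqn0; move: (size_subst_iter n w); rewrite e.
Qed.

(** No image is empty, so the lengths are nondecreasing in [n], and being unbounded amounts to
    tending to infinity. *)
Lemma long_lettersP a : long a <-> forall M, exists n, M <= size (subst_iter sigma n a).
Proof.
split=> [/cvgnyPge h M|h].
  by have [n _ hn] := h M; exists n; apply: hn => /=.
apply/cvgnyPge => M; have [n hn] := h M; exists n => // k /= nk.
exact: leq_trans hn (size_subst_iter_mono _ nk).
Qed.

Lemma short_bound : exists M, forall a n, short a -> size (subst_iter sigma n a) <= M.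
Proof.
apply: (@finite_uniform_bound A (fun a M => forall n, short a -> _ <= M)).
  by move=> a m n mn h k /(h k) /leq_trans; apply.
move=> a; have [la|sa] := pselect (long a); first by exists 0.
apply: contra_notP sa => /forallNP h; apply/long_lettersP => M.
have /existsNP[n /not_implyP[_ /negP]] := h M.
by rewrite -ltnNge => /ltnW; exists n.
Qed.

Lemma short_subst_iter n a b : short a -> b \in subst_iter sigma n a -> short b.
Proof.
move=> sa ba /long_lettersP lb; have [M hM] := short_bound.
have [k hk] := lb M.+1; move: (hM a (k + n) sa); apply/negP; rewrite -ltnNge.
apply: leq_trans hk _; rewrite subst_iterD; case/splitPr: ba => u v.
rewrite subst_iter_cat -cat1s subst_iter_cat !size_cat -/(subst_iter sigma k b).
by rewrite addnCA leq_addr.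
Qed.

(** Were all letters of sigma^n(a) short, [short_bound] would bound all later iterates of [a]. *)
Lemma long_subst_iter n a : long a -> exists2 b, long b & b \in subst_iter sigma n a.
Proof.
move=> /long_lettersP la; apply: contrapT => /forall2NP h.
have [M hM] := short_bound.
have [k] := la (M * size (subst_iter sigma n a)).+1; apply/negP; rewrite -leqNgt.
apply: leq_trans (size_subst_iter_mono a (leq_addr n k)) _.
rewrite subst_iterD subst_iter_flatten -(size_map (subst_iter sigma k) (subst_iter sigma n a)).
apply: size_flatten_le => s /mapP[b ba ->]; apply: hM.
by case: (h b).
Qed.

End Iterates.

(** * Short factors *)

Section FirstLong.
Variables (A : finType) (sigma : A -> seq A).
Hypothesis sigma_ne : forall a, sigma a <> [::].
Implicit Types (a b c d : A) (u v w : seq A).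

Local Notation pow n w := (iter n (subst_extend sigma) w).
Local Notation long := (long_letters sigma).
Local Notation short := (short_letters sigma).

Definition is_short : pred A := fun a => ~~ `[< long a >].

Lemma is_shortP a : reflect (short a) (is_short a).
Proof. exact: asboolPn. Qed.

Lemma all_shortP u : reflect (forall c, c \in u -> short c) (all is_short u).
Proof. by apply: (iffP allP) => h c /h /is_shortP. Qed.

Lemma all_short_subst n u : all is_short u -> all is_short (pow n u).
Proof.
move/all_shortP => h; apply/all_shortP => c /mem_subst_iter[b /h sb cb].
exact: short_subst_iter cb.
Qed.

(** For long [a] these cut sigma^n(a) at its first long letter; the default [a] is returned only
    when no long letter occurs. *)
Definition first_long n a := nth a (subst_iter sigma n a)
  (find (predC is_short) (subst_iter sigma n a)).
Definition short_prefix n a := take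
  (find (predC is_short) (subst_iter sigma n a)) (subst_iter sigma n a).

Lemma first_longP n a : long a ->
  [/\ all is_short (short_prefix n a), long (first_long n a) &
      exists r, subst_iter sigma n a = short_prefix n a ++ first_long n a :: r].
Proof.
move=> /(long_subst_iter sigma_ne n)[b lb ba].
have hasl : has (predC is_short) (subst_iter sigma n a).
  by apply/hasP; exists b => //=; apply/negP => /is_shortP.
split.
- apply/(all_nthP a) => i; rewrite size_take -has_find hasl => lt.
  by rewrite nth_take //; have /= /negbFE := before_find a lt.
- by have /= /negP h := nth_find a hasl; apply: contrapT => /is_shortP.
- exists (drop (find (predC is_short) (subst_iter sigma n a)).+1 (subst_iter sigma n a)).
  by rewrite -drop_nth -?has_find // cat_take_drop.
Qed.

Lemma first_long_uniq n a p b r : subst_iter sigma n a = p ++ b :: r ->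
  all is_short p -> long b -> short_prefix n a = p /\ first_long n a = b.
Proof.
move=> e sp lb; rewrite /short_prefix /first_long e.
have -> : find (predC is_short) (p ++ b :: r) = size p.
  have hp : has (predC is_short) p = false.
    by apply/negbTE; rewrite has_predC negbK.
  rewrite find_cat hp /= ifT ?addn0 //.
  by apply/negP => /is_shortP.
by rewrite take_size_cat // nth_cat ltnn subnn.
Qed.

(** Images of short words are short, so the first long letter of sigma^(m+n)(a) comes from that of
    sigma^n(a): first long letters follow the orbit of a self-map of the long letters. *)
Lemma first_longD m n a : long a ->
  short_prefix (m + n) a = pow m (short_prefix n a) ++ short_prefix m (first_long n a) /\
  first_long (m + n) a = first_long m (first_long n a).
Proof.
move=> la; have [sp lb [r e]] := first_longP n la.
have [sp' lb' [r' e']] := first_longP m lb.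
apply: (@first_long_uniq _ _ _ _ (r' ++ pow m r)) => //.
  rewrite subst_iterD e subst_iter_cat -cat1s subst_iter_cat -/(subst_iter sigma m _) e'.
  by rewrite -!catA.
by rewrite all_cat all_short_subst.
Qed.

Lemma size_subst_iter_short M n u :
  (forall a n, short a -> size (subst_iter sigma n a) <= M) ->
  all is_short u -> size (pow n u) <= M * size u.
Proof.
move=> hM /all_shortP su; rewrite subst_iter_flatten -(size_map (subst_iter sigma n) u).
by apply: size_flatten_le => s /mapP[b /su sb ->]; apply: hM.
Qed.

(* The sequence of first long letters of sigma^n(a) is eventually periodic; at a
   periodic letter b, tameness forces sigma^n(b) to begin with a long letter. *)
Lemma short_prefix_bound : (forall a, long a -> ~ left_isolated sigma a) ->
  exists P, forall n a v, prefix v (subst_iter sigma n a) -> all is_short v -> size v <= P.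
Proof.
move=> tame; have [M hM] := short_bound sigma_ne.
(* The pigeonhole is applied to whole functions of [a], so that [i] and [j] serve all letters at
   once. *)
have [i [j [ij eij]]] := finite_pigeonhole (fun n => [ffun a => first_long n a]).
have fix_pre a n : long a -> short_prefix n (first_long i a) = [::].
  move=> la; set b := first_long i a.
  have [_ lb _] := first_longP i la.
  have fb : first_long (j - i) b = b.
    rewrite -(first_longD _ _ la).2 subnK 1?ltnW //.
    by move/ffunP: eij => /(_ a); rewrite !ffunE.
  have pb : short_prefix (j - i) b = [::].
    apply: contrapT => pne; apply: (tame b lb).
    have [sp _ [r e]] := first_longP (j - i) lb.
    exists (j - i), (short_prefix (j - i) b), r; split; rewrite ?subn_gt0 //.
    - by split=> //; apply/all_shortP.
    - by rewrite e fb.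
  have per k : short_prefix (k * (j - i)) b = [::] /\ first_long (k * (j - i)) b = b.
    elim: k => [|k [pk fk]].
      by apply: (@first_long_uniq _ _ _ _ [::]).
    have [] := first_longD (j - i) (k * (j - i)) lb; rewrite -mulSn => -> ->.
    by rewrite fk pk fb pb cats0; split=> //; elim: (j - i) => //= ? ->.
  have le : n <= n * (j - i) by rewrite leq_pmulr ?subn_gt0.
  (* The empty short prefix at the multiple [n * (j - i)] begins with an image of the one at [n]; as
     nothing is erased, that one is empty too. *)
  have [] := first_longD (n * (j - i) - n) n lb.
  rewrite subnK // (per n).1 => /(congr1 size) /=.
  move/esym/eqP; rewrite size_cat addn_eq0 size_eq0 => /andP[/eqP e _] _.
  exact: (subst_iter_eq0 sigma_ne e).
have [Q hQ] := image_size_bound (subst_iter sigma i).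
(* The summands serve, in order, long [a] with [i <= n], short [a], and long [a] with [n < i]. *)
exists (M * Q + M + Q) => n a v /prefixP[y e] sv.
have [la|sa] := pselect (long a); last first.
  have := hM a n sa; rewrite e size_cat; lia.
have [sp lb [r er]] := first_longP n la.
have sle : size v <= size (short_prefix n a).
  have [//|lt] := leqP; exfalso.
  have : first_long n a \in v.
    have := congr1 (take (size v)) (etrans (esym e) er).
    rewrite take_size_cat // take_cat ltnNge (ltnW lt) /=.
    by rewrite -(subnSK lt) /= => ->; rewrite mem_cat mem_head orbT.
  by move/all_shortP: sv => h /h.
apply: leq_trans sle _; have [ni|ni] := leqP i n.
  have [+ _] := first_longD (n - i) i la; rewrite subnK // => ->.
  rewrite fix_pre // cats0.
  have [spi _ _] := first_longP i la.
  have := size_subst_iter_short (n - i) hM spi.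
  have : size (short_prefix i a) <= Q.
    by apply: leq_trans (hQ a); rewrite /short_prefix size_take; case: ltnP => // /ltnW.
  nia.
have : size (short_prefix n a) <= Q.
  apply: leq_trans (leq_trans (size_subst_iter_mono sigma_ne a (ltnW ni)) (hQ a)).
  by rewrite er size_cat leq_addr.
lia.
Qed.

(* With tau = sigma^n, tau(a) = u a w puts V = tau^(q-1)(u) ... tau(u) u before a
   in tau^q(a); images of short words are eventually periodic, so for suitable i
   and q the word v = tau^i(V) is fixed by tau^q and accumulates in front of
   tau^i(a). *)
Lemma left_isolated_powers a : left_isolated sigma a ->
  exists2 v, v <> [::] & forall k, language sigma (flatten (nseq k v)).
Proof.
move=> [n [u [w [n1 [une su] e]]]]; have [M hM] := short_bound sigma_ne.
have {}su : all is_short u by apply/all_shortP.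
(* The images of [u] have length at most [M * size u], so they live in a finite type of bounded
   words, into which [insub_bseq] embeds them unchanged. *)
have [i [j [ij eij]]] :=
  finite_pigeonhole (fun l => insub_bseq (M * size u) (pow (n * l) u)).
have {}eij : pow (n * i) u = pow (n * j) u.
  have := congr1 (fun s : bseq_of _ _ => s : seq A) eij.
  by rewrite /= /insub_bseq !insubdK // -topredE /= (size_subst_iter_short _ hM su).
have per k : exists V W, [/\ pow (n * (i + (j - i))) V = pow (n * i) V,
    subst_iter sigma (n * k) a = V ++ a :: W & k <= size V].
  elim: k => [|k [V [W [eV eVW kV]]]].
    by exists [::], [::]; rewrite muln0 !subst_iter_flatten.
  exists (pow n V ++ u), (w ++ pow n W); split.
  - rewrite !subst_iter_cat subnKC 1?(ltnW ij) // eij; congr (_ ++ _).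
    by rewrite -!iterD addnC [in RHS]addnC !iterD -eV subnKC 1?ltnW.
  - rewrite mulnS subst_iterD eVW subst_iter_cat -cat1s subst_iter_cat.
    by rewrite -/(subst_iter sigma n a) e -!catA.
  - rewrite size_cat -addn1 leq_add //.
      exact: leq_trans kV (size_subst_iter sigma_ne _ _).
    by case: (u) une.
(* With [k] equal to the period [q], the same power sigma^(nq) puts [V] before [a] and fixes
   sigma^(ni)(V); [0 < q] makes [V] nonempty. *)
have [V [W [eV eVW kV]]] := per (j - i); set q := j - i in eV eVW kV.
have q0 : 0 < q by rewrite subn_gt0.
set v := pow (n * i) V; have ev : pow (n * q) v = v.
  by rewrite /v -iterD -mulnDr addnC.
have vne : v <> [::] by move/(subst_iter_eq0 sigma_ne) => V0; move: kV; rewrite V0 leqNgt q0.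
exists v => // k; set z := subst_iter sigma (n * i) a.
have ez : pow (n * q) z = v ++ z ++ pow (n * i) W.
  rewrite /z -subst_iterD addnC subst_iterD eVW subst_iter_cat -cat1s subst_iter_cat.
  by [].
have zk l : exists y, pow (n * q * l) z = flatten (nseq l v) ++ z ++ y.
  elim: l => [|l [y ey]]; first by exists [::]; rewrite muln0 cats0.
  exists (pow (n * i) W ++ pow (n * q) y); rewrite mulnS iterD ey !subst_iter_cat ez.
  have -> : pow (n * q) (flatten (nseq l v)) = flatten (nseq l v).
    by elim: l {ey} => [|l IH] /=; rewrite ?subst_iter_cat ?IH ?ev // subst_iter_flatten.
  have -> : flatten (nseq l.+1 v) = flatten (nseq l v) ++ v.
    by rewrite -addn1 nseqD flatten_cat /= cats0.
  by rewrite -!catA.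
(* One extra copy of [v] keeps the exponent positive even for [k = 0], as the language demands. *)
have [y ey] := zk k.+1.
exists a, (n * q * k.+1 + n * i); split.
  by rewrite addn_gt0 !muln_gt0 n1 q0.
rewrite subst_iterD ey; apply: infix_catr.
by rewrite /= suffix_infix.
Qed.

End FirstLong.

Section Reversal.
Variables (A : finType) (sigma : A -> seq A).
Implicit Types (a b c d : A) (u v w : seq A).

(** The iterates of this mirrored substitution are the reversed iterates of [sigma], so each result
    on prefixes and left isolation yields its right-hand twin. *)
Definition rev_subst a := rev (sigma a).

Lemma rev_subst_iter n w :
  iter n (subst_extend rev_subst) (rev w) = rev (iter n (subst_extend sigma) w).
Proof.
elim: n => //= n ->; elim: (iter n _ w) => //= a v IH.
rewrite /subst_extend rev_cons map_rcons flatten_rcons /= rev_cat.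
by rewrite -/(subst_extend _ _) IH.
Qed.

Lemma rev_subst_iter1 n a : subst_iter rev_subst n a = rev (subst_iter sigma n a).
Proof. exact: (rev_subst_iter n [:: a]). Qed.

Lemma rev_long_letters : long_letters rev_subst = long_letters sigma.
Proof.
have e a : (fun n => size (subst_iter rev_subst n a)) = (fun n => size (subst_iter sigma n a)).
  by apply/funext => n; rewrite rev_subst_iter1 size_rev.
by apply/seteqP; split=> a; rewrite /long_letters /= e.
Qed.

Lemma rev_left_isolated a : left_isolated rev_subst a <-> right_isolated sigma a.
Proof.
rewrite /left_isolated /right_isolated /short_word /short_letters rev_long_letters.
split=> [[n [u [w [n1 [une su] e]]]]|[n [w [u [n1 [une su] e]]]]].
- exists n, (rev w), (rev u); split=> //.
    split=> [|c]; last by rewrite mem_rev => /su.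
    by move/(congr1 rev); rewrite revK.
  by rewrite -[LHS]revK -rev_subst_iter1 e rev_cat rev_cons cat_rcons.
- exists n, (rev u), (rev w); split=> //.
    split=> [|c]; last by rewrite mem_rev => /su.
    by move/(congr1 rev); rewrite revK.
  by rewrite rev_subst_iter1 e rev_cat rev_cons cat_rcons.
Qed.

Lemma rev_language w : language rev_subst w -> language sigma (rev w).
Proof.
move=> [a [n [n1 iw]]]; exists a, n; split=> //.
by move: iw; rewrite rev_subst_iter1 -infix_revLR.
Qed.

Lemma rev_is_short : is_short rev_subst = is_short sigma.
Proof. by rewrite /is_short rev_long_letters. Qed.

Hypothesis sigma_ne : forall a, sigma a <> [::].

Lemma rev_subst_ne a : rev_subst a <> [::].
Proof. by move/(congr1 rev); rewrite revK; apply: sigma_ne. Qed.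

Lemma right_isolated_powers a : right_isolated sigma a ->
  exists2 v, v <> [::] & forall k, language sigma (flatten (nseq k v)).
Proof.
move=> /rev_left_isolated /(left_isolated_powers rev_subst_ne)[v vne hv].
exists (rev v) => [/(congr1 rev)|k]; first by rewrite revK.
by have /rev_language := hv k; rewrite rev_flatten map_nseq rev_nseq.
Qed.

(* A short factor of sigma^n(sigma(a)) lies inside the image of one letter of
   sigma(a), or is cut by the images of these letters into short prefixes and
   suffixes. *)
Lemma short_infix_bound : tame sigma ->
  exists K, forall n a v, infix v (subst_iter sigma n a) -> all (is_short sigma) v ->
    size v <= K.
Proof.
move=> tame; have [a la|P hP] := short_prefix_bound sigma_ne; first exact: (tame a la).1.
have [a|Q hQ] := short_prefix_bound rev_subst_ne.
  by rewrite rev_long_letters => /tame[_ ra] /rev_left_isolated.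
have {}hQ n a v : suffix v (subst_iter sigma n a) -> all (is_short sigma) v -> size v <= Q.
  rewrite -prefix_rev -rev_subst_iter1 => /hQ; rewrite all_rev size_rev rev_is_short.
  by apply.
have [m hm] := image_size_bound sigma.
(* The 1 covers sigma^0(a), a single letter. The bound reproduces itself under induction, because a
   factor inside one image costs nothing new. *)
exists (maxn 1 ((P + Q) * m)); elim=> [|n IH] a v iv sv.
  by apply: leq_trans (size_infix iv) _; rewrite leq_max.
have e : subst_iter sigma n.+1 a = flatten (map (subst_iter sigma n) (sigma a)).
  rewrite -addn1 subst_iterD subst_iter_flatten /subst_iter /= /subst_extend /=.
  by rewrite cats0.
have : size v <= maxn (maxn 1 ((P + Q) * m)) ((P + Q) * size (map (subst_iter sigma n) (sigma a))).
  rewrite e in iv; apply: all_infix_flatten iv sv => s w /mapP[b _ ->].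
  - by move=> /hP h /h /leq_trans; apply; rewrite leq_addr.
  - by move=> /hQ h /h /leq_trans; apply; rewrite leq_addl.
  - exact: IH.
rewrite size_map; have := hm a; nia.
Qed.

End Reversal.

(** * Subshifts defined by words *)

Section Blocks.
Variable A : finType.
Implicit Types (x y : fullshift A) (s t : int) (m n : nat).

(* Unlike [window], given by its length, so that it may be empty. *)
Definition block x s n : seq A := [seq x (s + i%:Z)%R | i <- iota 0 n].

Lemma size_block x s n : size (block x s n) = n.
Proof. by rewrite size_map size_iota. Qed.

Lemma nth_block a x s n i : i < n -> nth a (block x s n) i = x (s + i%:Z)%R.
Proof. by move=> lt; rewrite (nth_map 0) ?size_iota // nth_iota. Qed.

Lemma eq_block x y s t n : (forall i, i < n -> x (s + i%:Z)%R = y (t + i%:Z)%R) ->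
  block x s n = block y t n.
Proof. by move=> h; apply/eq_in_map => i; rewrite mem_iota => /andP[_ /h]. Qed.

Lemma eq_blockP x y s t n : block x s n = block y t n ->
  forall i, i < n -> x (s + i%:Z)%R = y (t + i%:Z)%R.
Proof. by move=> e i lt; rewrite -!(nth_block (x s) _ _ lt) e. Qed.

Lemma block_cat x s m n : block x s (m + n) = block x s m ++ block x (s + m%:Z)%R n.
Proof.
rewrite /block iotaD map_cat; congr (_ ++ _); rewrite add0n -{1}[m]addn0 iotaDl -map_comp.
by apply: eq_map => i /=; congr (x _); lia.
Qed.

Lemma infix_block x s t m n : (t <= s)%R -> (s + m%:Z <= t + n%:Z)%R ->
  infix (block x s m) (block x t n).
Proof.
move=> ts sm; have en : n = `|s - t|%N + (m + (n - (`|s - t|%N + m))) by lia.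
have es : s = (t + `|s - t|%N%:Z)%R by lia.
by rewrite en !block_cat -es infix_infix.
Qed.

Lemma block_infix x s n w : infix w (block x s n) -> exists t, w = block x t (size w).
Proof.
move=> /infixP[u [v e]].
have en : n = size u + (size w + size v) by rewrite -!size_cat -e size_block.
exists (s + (size u)%:Z)%R; move: e; rewrite en !block_cat => /eqP.
rewrite eqseq_cat ?size_block // => /andP[_].
by rewrite eqseq_cat ?size_block // => /andP[/eqP->].
Qed.

(** [subst_shift sigma] is this set for [language sigma], by conversion; the general form also
    serves for the smaller languages used below. *)
Definition word_shift (P : set (seq A)) : set (fullshift A) :=
  [set x | forall s t, (s < t)%R -> P (window x s t)].

Definition infix_closed (P : set (seq A)) := forall u w, infix u w -> P w -> P u.

Lemma word_shiftP P x : infix_closed P ->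
  word_shift P x <-> forall s n, P (block x s n).
Proof.
move=> fP; split=> [h s n|h s t st]; last exact: (h s (absz (t - s)%R).+1).
(* Windows with [s < t] have at least two letters, so the block is placed in a longer window and cut
   out by closure under factors. *)
have lt : (s < s + n.+1%:Z)%R by lia.
apply: fP (h _ _ lt).
by apply: (@infix_block x s s n (absz (s + n.+1%:Z - s)%R).+1); lia.
Qed.

Lemma word_shift_mono P Q : P `<=` Q -> word_shift P `<=` word_shift Q.
Proof. by move=> PQ x h s t st; apply/PQ/h. Qed.

Lemma nbhs_block x s n : nbhs x [set y : fullshift A | block y s n = block x s n].
Proof.
elim: n => [|n IH]; first by apply: filterS filterT => y _.
have h : nbhs x [set y : fullshift A | y (s + n%:Z)%R = x (s + n%:Z)%R].
  exact: (@proj_continuous _ (fun=> discrete_topology A) (s + n%:Z)%R x _ (discrete_set1 _)).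
apply: filterS2 IH h => y /= e1 e2.
by rewrite -addn1 !block_cat e1 /block /= !addr0 e2.
Qed.

Lemma cvg_fullshift (u : nat -> fullshift A) x :
  (forall i, \forall k \near \oo, u k i = x i) -> u @ \oo --> x.
Proof.
move=> h; apply/cvg_sup => i U [V] [[W] oW <-] Wx WU.
by apply: filterS (h i) => k e; apply: WU; rewrite /= e.
Qed.

Lemma closed_word_shift P : closed (word_shift P).
Proof.
move=> x /= cx s t st; have [y [Py e]] := cx _ (nbhs_block x s (absz (t - s)%R).+1).
have -> : window x s t = window y s t by symmetry.
exact: Py.
Qed.

Lemma subshift_word_shift P : subshift (word_shift P).
Proof.
split; first exact: closed_word_shift.
apply/seteqP; split=> [_ [x Px <-] s t st|x Px].
  have := Px (s + 1)%R (t + 1)%R; have -> : window x (s + 1)%R (t + 1)%R = window (shift x) s t.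
    have -> : window x (s + 1)%R (t + 1)%R = block x (s + 1)%R (absz (t - s)%R).+1.
      by rewrite /window; congr [seq _ | i <- iota 0 (absz _).+1]; lia.
    by apply: eq_block => i _; rewrite /shift; congr x; lia.
  by apply; lia.
exists (fun i => x (i - 1)%R); last by apply/funext => i; rewrite /shift; congr x; lia.
move=> s t st; have := Px (s - 1)%R (t - 1)%R.
have -> : window x (s - 1)%R (t - 1)%R = block x (s - 1)%R (absz (t - s)%R).+1.
  by rewrite /window; congr [seq _ | i <- iota 0 (absz _).+1]; lia.
rewrite (@eq_block _ (fun i => x (i - 1)%R) _ s) => [|i _]; last by congr x; lia.
by apply; lia.
Qed.

Lemma compact_fullshift : compact [set: fullshift A].
Proof.
rewrite (_ : setT = [set x : fullshift A | forall i, [set: discrete_topology A] (x i)]).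
  apply: (@tychonoff int (fun=> discrete_topology A) (fun=> setT)) => _.
  exact/finite_compact/finite_finset.
by apply/seteqP; split.
Qed.

(** Compactness: long words of [P] centred at the origin have a cluster point, and on each window it
    agrees with arbitrarily late terms, whose blocks there lie in [P]. *)
Lemma word_shift_nonempty P : infix_closed P -> (forall n, exists2 w, P w & n <= size w) ->
  word_shift P !=set0.
Proof.
move=> fP Pbig.
have [a _] : exists a : A, True.
  by have [[|a w] _ //] := Pbig 1; exists a.
have /choice[w hw] : forall n, exists w, P w /\ n.*2 <= size w.
  by move=> n; have [w] := Pbig n.*2; exists w.
(* Only positions from -n to n-1 matter; the values elsewhere are arbitrary and never read. *)
pose u n : fullshift A := fun i => nth a (w n) (absz (i + n%:Z)%R).
have Pu s m n : (- n%:Z <= s)%R -> (s + m%:Z <= n%:Z)%R -> P (block (u n) s m).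
  move=> ns sm; have [Pw sw] := hw n; apply: fP Pw.
  have -> : block (u n) s m = take m (drop (absz (s + n%:Z)%R) (w n)).
    apply: (@eq_from_nth _ a) => [|i]; rewrite size_block.
      by rewrite size_takel // size_drop; lia.
    move=> im; rewrite nth_block // nth_take // nth_drop /u; congr nth; lia.
  exact: infix_trans (infix_take _ _) (infix_drop _ _).
have [x [_ clx]] := compact_fullshift (fmap_proper_filter u eventually_filter)
  (@filterT _ (u @ \oo) _).
exists x; apply/(word_shiftP _ fP) => s n.
have [|_ [[m mn <-] /= <-]] := clx (u @` [set k | ((absz s) + n <= k)%N]) _ _ (nbhs_block x s n).
  by exists ((absz s) + n) => // k /= ?; exists k.
by apply: Pu; move: mn => /=; lia.
Qed.

Definition translate (k : int) x : fullshift A := fun i => x (i + k)%R.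

Lemma iter_shift n x : iter n (@shift A) x = translate n%:Z x.
Proof.
elim: n => [|n /= ->]; apply/funext => i; rewrite /shift /translate; congr x; lia.
Qed.

(** Backward translates stay in [L] because the shift maps [L] onto itself and is injective. *)
Lemma subshift_translate (L : set (fullshift A)) k x : subshift L -> L x -> L (translate k x).
Proof.
move=> [_ sL] Lx; have pos n z : L z -> L (translate n%:Z z).
  rewrite -iter_shift => Lz; elim: n => //= n IH; rewrite -[X in X _]sL.
  by exists (iter n (@shift A) z).
have neg n : forall z, L z -> L (translate (- n%:Z)%R z).
  elim: n => [|n IH] z Lz.
    by rewrite (_ : translate _ z = z) //; apply/funext => i; congr z; lia.
  move: (Lz); rewrite -[X in X _]sL => -[y Ly ey].
  rewrite (_ : translate _ z = translate (- n%:Z)%R y); first exact: IH.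
  by apply/funext => i; rewrite /translate -ey /shift; congr y; lia.
have [k0|k0] : (0 <= k)%R \/ (k <= 0)%R by lia.
- have -> : k = ((absz k)%:Z)%R by lia.
  exact: pos.
- have -> : k = (- (absz k)%:Z)%R by lia.
  exact: neg.
Qed.

(** If every block of [y] occurs in [x], matching ever longer central blocks makes translates of [x]
    converge to [y], so a closed invariant set containing [x] contains [y]. *)
Lemma word_shift_minimal P :
  (forall x y s n, word_shift P x -> word_shift P y -> exists t, block x t n = block y s n) ->
  minimal_subshift (word_shift P).
Proof.
move=> h; split; first exact: subshift_word_shift.
move=> [L [sL [x Lx] [LP PL]]]; apply: PL => y Py.
have /choice[t ht] : forall m, exists t, block x t m.*2 = block y (- m%:Z)%R m.*2.
  by move=> m; apply: h => //; apply: LP.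
have cL : closed L := sL.1.
apply: (closed_cvg (F := \oo) (u_ := fun m => translate (t m + m%:Z)%R x) L cL _ y).
  by apply: nearW => m; apply: subshift_translate.
apply: cvg_fullshift => i; exists (absz i).+1 => // m /= im.
have := eq_blockP (ht m) (i := (absz (i + m%:Z)%R)); rewrite /translate.
have -> : (- m%:Z + (absz (i + m%:Z)%R)%:Z)%R = i by lia.
move=> <-; last by lia.
by congr x; lia.
Qed.

Lemma minimal_eq (X Y : set (fullshift A)) : minimal_subshift X -> subshift Y ->
  Y !=set0 -> Y `<=` X -> Y = X.
Proof.
move=> [_ minX] sY Y0 YX; apply: contrapT => ne; apply: minX; exists Y; split=> //.
by rewrite properEneq; split=> //; apply/eqP.
Qed.

(** The orbit is finite, hence closed in a Hausdorff space; the shift preimage of an orbit point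
    lies [p.-1] steps ahead. *)
Lemma subshift_periodic_orbit x p : 0 < p -> iter p (@shift A) x = x ->
  subshift (range (fun n => iter n (@shift A) x)).
Proof.
move=> p0 ep; split; last first.
  apply/seteqP; split=> [_ [_ [n _ <-] <-]|_ [n _ <-]]; first by exists n.+1.
  exists (iter (n + p.-1) (@shift A) x); first by exists (n + p.-1).
  by rewrite -iterS -addnS prednK // iterD ep.
have hx : hausdorff_space (fullshift A).
  by apply: (@hausdorff_product int (fun=> discrete_topology A)) => i; apply: discrete_hausdorff.
have /accessible_finite_set_closed : accessible_space (fullshift A) by exact: hausdorff_accessible.
apply; apply: (@sub_finite_set _ _ ((fun n => iter n (@shift A) x) @` `I_p)).
  move=> _ [n _ <-]; exists (n %% p); first exact: ltn_pmod.
  rewrite {2}(divn_eq n p) addnC iterD; congr iter.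
  by elim: (n %/ p) => //= k IH; rewrite mulSn iterD -IH ep.
exact/finite_image/finite_II.
Qed.

(** A point whose blocks are all factors of powers of [v] has period [size v]; its orbit is a
    subshift, so by minimality it is everything. *)
Lemma minimal_powers P (v : seq A) : infix_closed P -> minimal_subshift (word_shift P) ->
  v <> [::] -> (forall k, P (flatten (nseq k v))) -> periodic_orbit (word_shift P).
Proof.
move=> fP minP vne Pv.
pose Q := [set w | exists k, infix w (flatten (nseq k v))].
have fQ : infix_closed Q by move=> u w uw [k wk]; exists k; apply: infix_trans uw wk.
have v0 : 0 < size v by case: (v) vne.
have [x Qx] : word_shift Q !=set0.
  apply: word_shift_nonempty => // n; exists (flatten (nseq n v)).
    by exists n; apply: infix_refl.
  by rewrite size_flatten /shape map_nseq sumn_nseq leq_pmull.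
have QP : Q `<=` P by move=> w [k /fP]; apply.
have perx : iter (size v) (@shift A) x = x.
  apply/funext => i; rewrite iter_shift /translate.
  have [k [u [z e]]] : exists k (u z : seq A),
      flatten (nseq k v) = u ++ block x i (size v).+1 ++ z.
    by have [k /infixP[u [z e]]] := (word_shiftP x fQ).1 Qx i (size v).+1; exists k, u, z.
  pose a : A := x i.
  have -> : x i = nth a (block x i (size v).+1) 0 by rewrite nth_block // addr0.
  have -> : x (i + size v)%R = nth a (block x i (size v).+1) (size v) by rewrite nth_block.
  have lk : size u + (size v).+1 <= size (flatten (nseq k v)).
    by rewrite e !size_cat size_block addnA leq_addr.
  have en j : j < (size v).+1 ->
      nth a (block x i (size v).+1) j = nth a (flatten (nseq k v)) (size u + j).
    move=> lt; rewrite e nth_cat ifF; last by rewrite ltnNge leq_addr.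
    by rewrite addKn nth_cat size_block lt.
  rewrite !en // addn0; case: k lk {e en} => [|k]; first by rewrite /= addnS.
  have e2 : flatten (nseq k.+1 v) = flatten (nseq k v) ++ v.
    by rewrite -addn1 nseqD flatten_cat /= cats0.
  (* One position is read in v^k v and the other, [size v] further, in v v^k; both give the same
     letter of v^k. *)
  rewrite {3}e2 nth_cat => lk; rewrite ifT.
    by rewrite /= nth_cat ltnNge leq_addl /= addnK.
  by move: lk; rewrite /= size_cat; lia.
exists x, (size v); split=> //; symmetry.
apply: (minimal_eq minP); first exact: subshift_periodic_orbit perx.
  by exists x; exists 0.
move=> _ [n _ <-]; rewrite iter_shift.
exact: (subshift_translate _ (@subshift_word_shift P) (word_shift_mono QP Qx)).
Qed.

End Blocks.

(** * Minimality *)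

Section Minimality.
Variables (A : finType) (sigma : A -> seq A).
Hypothesis hsigma : substitution sigma.
Implicit Types (a b c d : A) (u v w : seq A).

Local Notation long := (long_letters sigma).

Let sigma_ne : forall a, sigma a <> [::].
Proof. by have [] := hsigma. Qed.

Lemma infix_closed_language : infix_closed (language sigma).
Proof. by move=> u w uw [a [n [n1 wa]]]; exists a, n; split=> //; apply: infix_trans wa. Qed.

(** A short [a] is not isolated, so it occurs in an iterate of some long letter, which then produces
    [w] too. *)
Lemma language_long w : language sigma w ->
  exists a n, [/\ long a, 1 <= n & infix w (subst_iter sigma n a)].
Proof.
move=> [a [n [n1 wa]]]; have [la|sa] := pselect (long a); first by exists a, n.
have [_ _ iso0] := hsigma.
have : ~ isolated_letters sigma a by rewrite iso0.
move/not_andP => [//|/existsNP[b /existsNP[m /not_implyP[lb /not_implyP[m1 /negP]]]]].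
rewrite negbK => ab; exists b, (n + m); split=> //; first by rewrite addn_gt0 n1.
apply: infix_trans wa _; rewrite subst_iterD.
by apply: (@infix_subst_iter _ _ n [:: a]); rewrite infix1s.
Qed.

Lemma tame_primitive_minimal : tame sigma -> l_primitive sigma ->
  minimal_subshift (subst_shift sigma).
Proof.
move=> tm [N N1 prim]; apply: word_shift_minimal => x y s n Xx Xy.
have fL := infix_closed_language.
have /language_long[a [m [la m1 wa]]] := (word_shiftP y fL).1 Xy s n.
(* After [N] steps every long letter has produced [a], and [m] further steps produce [w]. *)
set w := block y s n in wa *; pose q := m + N.
have wq b : long b -> infix w (subst_iter sigma q b).
  move=> lb; apply: infix_trans wa _; rewrite subst_iterD.
  by apply: (@infix_subst_iter _ _ m [:: a]); rewrite infix1s; apply: prim.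
have [C hC] := image_size_bound (subst_iter sigma q).
have [K hK] := short_infix_bound sigma_ne tm.
(* A block this long exceeds [C], which forces [q <= k], and desubstitutes to a word longer than
   [K], which must contain a long letter. *)
pose R := (C * K.+2).+1.
have [c [k [k1 ck]]] := (word_shiftP x fL).1 Xx 0%R R.
have qk : q <= k.
  rewrite leqNgt; apply/negP => /ltnW /(size_subst_iter_mono sigma_ne c) le.
  have : R <= C by rewrite -(size_block x 0%R R) (leq_trans (size_infix ck)) // (leq_trans le).
  by rewrite /R ltnNge leq_pmulr.
rewrite -(subnKC qk) subst_iterD subst_iter_flatten in ck.
have [v [vk vx Rv]] := infix_desubst hC ck.
have {}Rv : R <= C * (size v).+2 by rewrite -(size_block x 0%R R).
have /allPn[b bv lb] : ~~ all (is_short sigma) v.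
  apply/negP => /(hK _ _ _ vk) le.
  have := leq_trans Rv (leq_mul (leqnn C) (le : (size v).+2 <= K.+2)).
  by rewrite ltnn.
have wx : infix w (block x 0%R R).
  apply: infix_trans vx; rewrite negbK in lb; move/asboolP: lb => /wq wb.
  apply: infix_trans wb _; case/splitPr: bv => v1 v2.
  by rewrite map_cat flatten_cat /= infix_infix.
have [t ->] := block_infix wx; exists t.
by rewrite size_block.
Qed.

(** The letter sets of sigma^n(a), for all [a] together, agree at some [i < j]. Each determines the
    next, so they have period [j - i] from [i] on; [N] is a multiple of this period beyond [i]. *)
Lemma iterate_letters_idem : exists2 N, 1 <= N &
  forall k a c, 1 <= k -> c \in subst_iter sigma (k * N) a -> c \in subst_iter sigma N a.
Proof.
have [i [j [ij eij]]] :=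
  finite_pigeonhole (fun n => [ffun a => [set c in subst_iter sigma n a]%SET]).
have {}eij a c : (c \in subst_iter sigma i a) = (c \in subst_iter sigma j a).
  by move/ffunP: eij => /(_ a); rewrite !ffunE => /finset.setP /(_ c); rewrite !inE.
pose q := j - i.
have step n a c : i <= n ->
    c \in subst_iter sigma (n + q) a -> c \in subst_iter sigma n a.
  move=> le; rewrite (_ : n + q = n - i + j); last by rewrite /q; lia.
  rewrite subst_iterD => /mem_subst_iter[b]; rewrite -eij => bi cb.
  by rewrite -(subnK le) subst_iterD; apply: mem_subst_iterI cb.
have q0 : 0 < q by rewrite subn_gt0.
have steps l n a c : i <= n ->
    c \in subst_iter sigma (n + l * q) a -> c \in subst_iter sigma n a.
  elim: l => [|l IH] le; first by rewrite addn0.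
  by rewrite mulSn addnCA addnC => /step h; apply: IH le (h (leq_trans le (leq_addr _ _))).
exists (j * q) => [|k a c k1]; first by rewrite muln_gt0 q0; lia.
have -> : k * (j * q) = j * q + (k.-1 * j) * q by nia.
by apply: steps; nia.
Qed.

Lemma minimal_tame : minimal_subshift (subst_shift sigma) ->
  ~ periodic_orbit (subst_shift sigma) -> tame sigma.
Proof.
move=> minX nper a la; have fL := infix_closed_language.
split=> [/(left_isolated_powers sigma_ne)|/(right_isolated_powers sigma_ne)] [v vne hv];
  exact: nper (minimal_powers fL minX vne hv).
Qed.

Lemma minimal_recurrent_letter : minimal_subshift (subst_shift sigma) -> tame sigma ->
  exists N d0, [/\ 1 <= N, long d0, (forall d, long d -> d0 \in subst_iter sigma N d) &
    forall k a c, 1 <= k -> c \in subst_iter sigma (k * N) a -> c \in subst_iter sigma N a].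
Proof.
move=> minX tm; have [N N1 idem] := iterate_letters_idem.
have fL := infix_closed_language.
pose P d : set (seq A) := [set w | exists2 k, 1 <= k & infix w (subst_iter sigma (k * N) d)].
have fP d : infix_closed (P d).
  by move=> u w uw [k k1 wk]; exists k => //; apply: infix_trans wk.
have PL d : P d `<=` language sigma.
  by move=> w [k k1 wk]; exists d, (k * N); split; rewrite ?muln_gt0 ?k1.
have Pne d : long d -> word_shift (P d) !=set0.
  move=> ld; apply: word_shift_nonempty (fP d) _ => n.
  have [m hm] := (long_lettersP sigma_ne d).1 ld n.
  exists (subst_iter sigma (m.+1 * N) d); first by exists m.+1 => //; apply: infix_refl.
  by apply: leq_trans hm (size_subst_iter_mono sigma_ne _ _); nia.
have PX d : long d -> word_shift (P d) = subst_shift sigma.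
  move=> ld; apply: minimal_eq minX (@subshift_word_shift _ _) (Pne d ld) _.
  exact: word_shift_mono (PL d).
have [_ [l ll] _] := hsigma.
have [x Xx] := Pne l ll; rewrite PX // in Xx.
have [K hK] := short_infix_bound sigma_ne tm.
have [a [n [n1 xa]]] := (word_shiftP x fL).1 Xx 0%R K.+1.
have /allPn[d0 dx ld0] : ~~ all (is_short sigma) (block x 0%R K.+1).
  by apply/negP => /(hK _ _ _ xa); rewrite size_block ltnn.
rewrite negbK in ld0; move/asboolP: ld0 => ld0.
exists N, d0; split=> // d ld.
move: Xx; rewrite -(PX d ld) => /(word_shiftP x (fP d)) /(_ 0%R K.+1)[k k1 /mem_infix /(_ _ dx)].
exact: idem.
Qed.

End Minimality.

(** * Restriction to a stable subalphabet *)

Section Restriction.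
Variables (A : finType) (sigma : A -> seq A) (B : {set A}).
Hypothesis stableB : stable sigma B.
Local Notation Bt := {b : A | b \in B}.
Local Notation tau := (subst_restrict sigma B).
Implicit Types (b : Bt) (w : seq Bt).

Lemma map_val_pmap_insub (s : seq A) : {subset s <= B} ->
  map val (pmap (insub : A -> option Bt) s) = s.
Proof.
move=> sB; rewrite (pmap_filter (insubK _)); apply/all_filterP/allP => c /sB cB /=.
by rewrite isSome_insub.
Qed.

Lemma restrict_iter n w : map val (iter n (subst_extend tau) w) =
  iter n (subst_extend sigma) (map val w).
Proof.
elim: n => //= n <-; elim: (iter n _ w) => //= b v IH.
rewrite /subst_extend /= map_cat -/(subst_extend tau v) IH map_val_pmap_insub //.
by move=> c; apply: stableB; apply: valP.
Qed.

Lemma restrict_subst_iter n b : map val (subst_iter tau n b) = subst_iter sigma n (val b).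
Proof. exact: (restrict_iter n [:: b]). Qed.

Lemma mem_restrict n b c :
  (c \in subst_iter tau n b) = (val c \in subst_iter sigma n (val b)).
Proof. by rewrite -restrict_subst_iter mem_map //; apply: val_inj. Qed.

Lemma restrict_long b : long_letters tau b = long_letters sigma (val b).
Proof.
rewrite /long_letters /=.
suff -> : (fun n => size (subst_iter tau n b)) = fun n => size (subst_iter sigma n (val b)) by [].
by apply/funext => n; rewrite -restrict_subst_iter size_map.
Qed.

Lemma restrict_short_word w : short_word tau w -> short_word sigma (map val w).
Proof.
move=> [wne ws]; split; first by case: (w) wne.
by move=> _ /mapP[b /ws sb ->] lb; apply: sb; rewrite restrict_long.
Qed.

Lemma restrict_tame : tame sigma -> tame tau.
Proof.
move=> tm b; rewrite restrict_long => /tm[nl nr]; split.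
- move=> [n [u [w [n1 /restrict_short_word su e]]]]; apply: nl.
  exists n, (map val u), (map val w); split=> //.
  by rewrite -restrict_subst_iter e map_cat.
- move=> [n [w [u [n1 /restrict_short_word su e]]]]; apply: nr.
  exists n, (map val w), (map val u); split=> //.
  by rewrite -restrict_subst_iter e map_cat.
Qed.

Lemma infix_map_val (u w : seq Bt) : infix (map val u) (map val w) = infix u w.
Proof.
apply/idP/idP => [/infixP[p [q e]]|/infixP[p [q ->]]]; last first.
  by rewrite !map_cat infix_infix.
have valKp : cancel (map val) (pmap (insub : A -> option Bt)) by apply: map_pK; apply: valK.
apply/infixP; exists (pmap insub p), (pmap insub q).
by rewrite -[LHS]valKp e !pmap_cat valKp.
Qed.

(** The language of the restriction, written over [A], so that its shift can be compared with X
    inside the same full shift. *)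
Definition language_from : set (seq A) :=
  [set w | exists2 b, b \in B & exists2 n, 1 <= n & infix w (subst_iter sigma n b)].

Lemma infix_closed_language_from : infix_closed language_from.
Proof.
by move=> u w uw [b bB [n n1 wn]]; exists b => //; exists n => //; apply: infix_trans wn.
Qed.

Lemma stable_iter n a c : a \in B -> c \in subst_iter sigma n a -> c \in B.
Proof.
move=> aB; have := restrict_subst_iter n (exist _ a aB) => /= <- /mapP[b _ ->].
exact: valP.
Qed.

Lemma word_shift_from_letters x i : word_shift language_from x -> x i \in B.
Proof.
move=> /(word_shiftP x infix_closed_language_from) /(_ i 1)[b bB [n _]].
by rewrite /block /= addr0 infix1s; apply: stable_iter.
Qed.

Lemma include_restrict_shift :
  include_full (B := B) @` subst_shift tau = word_shift language_from.
Proof.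
have winE (y : fullshift Bt) s t : window (include_full y) s t = map val (window y s t).
  by rewrite /window -map_comp.
apply/seteqP; split=> [_ [y Xy <-] s t st|x Xx].
  have [b [n [n1 yn]]] := Xy s t st; exists (val b); first exact: valP.
  by exists n => //; rewrite winE -restrict_subst_iter infix_map_val.
pose y : fullshift Bt := fun i => exist _ (x i) (word_shift_from_letters i Xx).
have ey : include_full y = x by apply/funext.
exists y => // s t st; have [b bB [n n1]] := Xx s t st.
rewrite -ey winE -[b]/(val (exist (fun c : A => c \in B) b bB)) -restrict_subst_iter infix_map_val.
by move=> yn; exists (exist (fun c : A => c \in B) b bB), n.
Qed.

End Restriction.

Theorem theorem1 (A : finType) (hA : (1 < #|A|)%N) (sigma : A -> seq A)
    (hsigma : substitution sigma) :
  (tame sigma -> l_primitive sigma -> minimal_subshift (subst_shift sigma)) /\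
  (minimal_subshift (subst_shift sigma) -> ~ periodic_orbit (subst_shift sigma) ->
     tame sigma /\
     exists B : {set A},
       (1 < #|B|)%N /\
       stable sigma B /\
       substitution (subst_restrict sigma B) /\
       tame (subst_restrict sigma B) /\
       l_primitive (subst_restrict sigma B) /\
       subst_shift sigma = include_full (B := B) @` subst_shift (subst_restrict sigma B)).
Proof.
split; first exact: tame_primitive_minimal.
move=> minX nper; have tm := minimal_tame hsigma minX nper; split=> //.
have [sigma_ne _ _] := hsigma.
have [N [d0 [N1 ld0 rec idem]]] := minimal_recurrent_letter hsigma minX tm.
pose B := [set b : A | `[< exists n, b \in subst_iter sigma n d0 >]]%SET.
have inB b : reflect (exists n, b \in subst_iter sigma n d0) (b \in B).
  by rewrite inE; apply: asboolP.
have d0B : d0 \in B by apply/inB; exists 0; rewrite mem_head.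
have stB : stable sigma B.
  move=> b c /inB[n bn] cb; apply/inB; exists (1 + n); apply: mem_subst_iterD bn _.
  by rewrite /subst_iter /= /subst_extend /= cats0.
(* Choosing a long letter e of sigma^(n * N - n)(d0) makes the total exponent of
   the route d0 -> e -> d0 -> c a multiple of N. *)
have longB c : c \in B -> long_letters sigma c -> c \in subst_iter sigma N d0.
  move=> /inB[n cn] lc.
  have [e le er] := long_subst_iter sigma_ne (n * N - n) ld0.
  apply: (idem n.+1) => //.
  rewrite (_ : n.+1 * N = (n + N) + (n * N - n)); last by nia.
  exact: mem_subst_iterD er (mem_subst_iterD (rec e le) cn).
have LB0 : word_shift (language_from sigma B) !=set0.
  apply: word_shift_nonempty (@infix_closed_language_from _ _ _) _ => n.
  have [m hm] := (long_lettersP sigma_ne d0).1 ld0 n.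
  exists (subst_iter sigma m.+1 d0); last exact: leq_trans hm (size_subst_iter_mono sigma_ne _ _).
  by exists d0 => //; exists m.+1 => //; apply: infix_refl.
have eX : subst_shift sigma = word_shift (language_from sigma B).
  symmetry; apply: minimal_eq minX (@subshift_word_shift _ _) LB0 _.
  by apply: word_shift_mono => w [b _ [n n1 wn]]; exists b, n.
exists B; split; [|split=> //; split; [|split; [|split]]].
(* With a single letter in [B], X would be one constant point, hence a periodic orbit. *)
- rewrite ltnNge; apply/negP => /card_le1_eqP B1; apply: nper.
  have const x : subst_shift sigma x -> x = (fun=> d0) :> fullshift A.
    rewrite eX => Xx; apply/funext => i; apply: B1 => //.
    exact: word_shift_from_letters Xx.
  have [x Xx] := LB0; rewrite -eX in Xx.
  exists x, 1; have sx : shift x = x by rewrite (const x Xx).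
  split=> //; apply/seteqP; split=> [y Xy|_ [n _ <-]].
    by exists 0 => //=; rewrite (const x Xx) (const y Xy).
  by rewrite iter_fix.
- have lrE := restrict_long stB; split.
  + move=> b /(congr1 (map val)); rewrite map_val_pmap_insub; first exact: sigma_ne.
    by move=> c; apply: stB; apply: valP.
  + by exists (exist _ d0 d0B); rewrite lrE.
  + apply/seteqP; split=> // b [sb iso].
    have /inB[n bn] := valP b.
    (* Exponent 0 would make [b] the long letter [d0] itself. *)
    have n0 : 1 <= n.
      case: n bn => // bd0; case: sb; rewrite lrE.
      by move: bd0; rewrite inE => /eqP ->.
    have := iso (exist _ d0 d0B) n; rewrite lrE mem_restrict // bn.
    by move=> /(_ ld0 n0).
- exact: restrict_tame stB tm.
(* [N] steps lead from any long letter to [d0], and [N] more to any long letter of [B]. *)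
- exists (N + N); first by rewrite addn_gt0 N1.
  move=> a b; rewrite !(restrict_long stB) mem_restrict // => la lb.
  apply: mem_subst_iterD (rec _ lb) _; apply: longB => //; exact: valP.
- by rewrite eX include_restrict_shift.
Qed.
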